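(* If a connected, proper Dupin submanifold $\lambda:M^{n-1}\to\Lambda^{2n-1}$ is reducible on a nonempty open subset $U$ of $M$, then it is reducible. Thus, a connected, proper Dupin submanifold is locally irreducible if and only if it is irreducible.
   Context: $\mathbb{R}^{n+3}_2$ is $\mathbb{R}^{n+3}$ with the form $\langle x,y\rangle=-x^0y^0+x^1y^1+\dots+x^{n+1}y^{n+1}-x^{n+2}y^{n+2}$, $Q\subset\mathbf{RP}^{n+2}$ is the Lie quadric $\langle x,x\rangle=0$, and $\Lambda^{2n-1}$ is the manifold of projective lines contained in $Q$; $[x,y]$ is the line through $[x],[y]$. A Legendre submanifold is an immersion $\lambda:M^{n-1}\to\Lambda^{2n-1}$ such that, locally writing $\lambda=[Y_0,Y_1]$, $\langle dY_0,Y_1\rangle=0$. A curvature sphere at $p$ is a point $[rY_0(p)+sY_1(p)]$, $(r,s)\ne(0,0)$, for which some nonzero $X\in T_pM$ satisfies $r\,dY_0(X)+s\,dY_1(X)\in\mathrm{span}\{Y_0(p),Y_1(p)\}$; such $X$ (with $0$) form its principal space. A curvature surface is a smooth connected submanifold whose tangent space at each point is a principal space. $\lambda$ is Dupin if along each curvature surface the corresponding curvature sphere is constant, and proper Dupin if also the number of distinct curvature spheres is constant on $M$. Standing convention: every proper Dupin submanifold is real analytic (known), so $M$, $\lambda$ and the curvature sphere maps are real analytic; the distinct curvature spheres are regarded as real analytic maps $M\to Q$. $\lambda$ is reducible on an open subset $O\subset M$ if some curvature sphere maps $O$ into some fixed linear subspace of $\mathbf{RP}^{n+2}$ of codimension at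 least two; it is reducible if it is reducible on $M$; irreducible if it is not reducible; locally irreducible if it is not reducible on any (nonempty) open subset of $M$. *)

(* Defs.v *)
From HB Require Import structures.
From mathcomp Require Export all_boot all_order all_algebra.
From mathcomp Require Export all_classical all_reals all_analysis.

#[global] Set Implicit Arguments.
#[global] Unset Strict Implicit.
#[global] Unset Printing Implicit Defensive.

Export Order.TTheory GRing.Theory Num.Theory.
Export numFieldNormedType.Exports.

Local Open Scope classical_set_scope.
Local Open Scope ring_scope.

Definition monomial (R : realType) (m : nat) (h : 'rV[R]_m)
    (a : {ffun 'I_m -> nat}) : R :=
  \prod_(i < m) h 0 i ^+ a i.

(* [f] is the sum of an absolutely convergent power series in [m] variables on
   a polydisc about [x] (the norm of 'rV[R]_m is the sup norm).  Because of
   absolute convergence the sum may be computed along the cubes {0..N-1}^m. *)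
Definition analytic_at (R : realType) (m : nat) (f : 'rV[R]_m -> R)
    (x : 'rV[R]_m) : Prop :=
  exists (c : {ffun 'I_m -> nat} -> R) (r : R), 0 < r /\
    forall h : 'rV[R]_m, `|h| < r ->
      summable [set: {ffun 'I_m -> nat}] (fun a => (c a * monomial h a)%:E) /\
      (\sum_(a : {ffun 'I_m -> 'I_N})
          c [ffun i => val (a i)] * monomial h [ffun i => val (a i)])
        @[N --> \oo] --> f (x + h).

Definition analytic_mx_at (R : realType) (m k l : nat)
    (f : 'rV[R]_m -> 'M[R]_(k, l)) (x : 'rV[R]_m) : Prop :=
  forall i j, analytic_at (fun u => f u i j) x.

(* Class C^k on a neighbourhood of [x]; meant for finite-dimensional [V]. *)
Fixpoint ck_at (R : realType) (V W : normedModType R) (k : nat)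
    (f : V -> W) (x : V) : Prop :=
  match k with
  | 0%N => \forall y \near x, {for y, continuous f}
  | k'.+1 => (\forall y \near x, differentiable f y) /\
             (forall v : V, ck_at k' ('D_v f) x)
  end.

Definition smooth_at (R : realType) (V W : normedModType R)
    (f : V -> W) (x : V) : Prop :=
  forall k, ck_at k f x.

(* [chart_map] and [chart_inv] are total functions, meaningful only on
   [chart_dom] and on its image. *)
Record chart (R : realType) (M : topologicalType) (m : nat) := Chart {
  chart_dom : set M;
  chart_map :> M -> 'rV[R]_m;
  chart_inv : 'rV[R]_m -> M;
  chart_dom_open : open chart_dom;
  chart_img_open : open (chart_map @` chart_dom);
  chart_mapK : {in chart_dom, cancel chart_map chart_inv};
  chart_map_continuous :
    forall p, chart_dom p -> {for p, continuous chart_map};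
  chart_inv_continuous :
    forall u, (chart_map @` chart_dom) u -> {for u, continuous chart_inv}
}.

Record analytic_manifold (R : realType) (M : topologicalType) (m : nat) :=
  AnalyticManifold {
  atlas : set (chart R M m);
  manifold_hausdorff : hausdorff_space M;
  manifold_second_countable : @second_countable M;
  atlas_cover : forall p : M, exists2 phi, atlas phi & chart_dom phi p;
  atlas_compatible : forall phi psi, atlas phi -> atlas psi ->
    forall p, chart_dom phi p -> chart_dom psi p ->
      analytic_mx_at (psi \o chart_inv phi) (phi p)
}.

Definition chart_at (R : realType) (M : topologicalType) (m : nat)
    (A : analytic_manifold R M m) (p : M) : set (chart R M m) :=
  [set phi | atlas A phi /\ chart_dom phi p].

(* Throughout, a chart [phi] at [p] identifies T_pM with 'rV[R]_m; this is the
   differential at [p] of [Y] applied to the tangent vector of coordinates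
   [X]. *)
Definition diff_in (R : realType) (M : topologicalType) (m k l : nat)
    (phi : chart R M m) (Y : M -> 'M[R]_(k, l)) (p : M) (X : 'rV[R]_m) :
    'M[R]_(k, l) :=
  'D_X (Y \o chart_inv phi) (phi p).

Definition analytic_on (R : realType) (M : topologicalType) (m k l : nat)
    (A : analytic_manifold R M m) (W : set M) (Y : M -> 'M[R]_(k, l)) : Prop :=
  forall p phi, W p -> chart_at A p phi ->
    analytic_mx_at (Y \o chart_inv phi) (phi p).

(* The (d-1)-dimensional linear subspaces of RP^(N-1) are the d-dimensional
   vector subspaces of R^N: points for d = 1, lines for d = 2. *)

Definition row_span (R : realType) (k N : nat) (Z : 'M[R]_(k, N)) :
    {vspace 'rV[R]_N} :=
  <<[seq row i Z | i <- enum 'I_k]>>%VS.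

(* The standard affine charts of the Grassmannian of k-dimensional subspaces
   of R^N: for a choice [I] of [k] columns, a subspace [L] in the chart domain
   is sent to its unique basis matrix whose columns [I] form the identity. *)
Definition gr_normalized (R : realType) (k N : nat) (I : 'I_k -> 'I_N)
    (L : {vspace 'rV[R]_N}) : set 'M[R]_(k, N) :=
  [set Z | row_span Z = L /\ colsub I Z = 1%:M].

Definition gr_dom (R : realType) (k N : nat) (I : 'I_k -> 'I_N) :
    set {vspace 'rV[R]_N} :=
  [set L | gr_normalized I L !=set0].

Definition gr_coord (R : realType) (k N : nat) (I : 'I_k -> 'I_N)
    (L : {vspace 'rV[R]_N}) : 'M[R]_(k, N) :=
  xget 0 (gr_normalized I L).

Definition gr_analytic (R : realType) (M : topologicalType) (m k N : nat)
    (A : analytic_manifold R M m) (L : M -> {vspace 'rV[R]_N}) : Prop :=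
  forall p, exists (I : 'I_k -> 'I_N) (W : set M),
    [/\ open W, W p, (forall q, W q -> gr_dom I (L q)) &
        analytic_on A W (gr_coord I \o L)].

Definition gr_immersion (R : realType) (M : topologicalType) (m k N : nat)
    (A : analytic_manifold R M m) (L : M -> {vspace 'rV[R]_N}) : Prop :=
  gr_analytic k A L /\
  forall p phi (I : 'I_k -> 'I_N), chart_at A p phi -> gr_dom I (L p) ->
    forall X, diff_in phi (gr_coord I \o L) p X = 0 -> X = 0.

Definition lie_form (R : realType) (n : nat) (x y : 'rV[R]_n.+3) : R :=
  \sum_(i < n.+3) (-1) ^+ ((i == ord0) || (i == ord_max)) * (x 0 i * y 0 i).

Definition lie_quadric (R : realType) (n : nat) : set {vspace 'rV[R]_n.+3} :=
  [set K | \dim K = 1%N /\ forall x, x \in K -> lie_form x x = 0].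

(* The projective lines contained in the Lie quadric. *)
Definition lie_lines (R : realType) (n : nat) : set {vspace 'rV[R]_n.+3} :=
  [set L | \dim L = 2%N /\ forall x, x \in L -> lie_form x x = 0].

(* [lambda = [Y0, Y1]] on the open set [W]. *)
Definition lie_frame (R : realType) (M : topologicalType) (m n : nat)
    (A : analytic_manifold R M m) (lambda : M -> {vspace 'rV[R]_n.+3})
    (W : set M) (Y0 Y1 : M -> 'rV[R]_n.+3) : Prop :=
  [/\ open W, analytic_on A W Y0, analytic_on A W Y1 &
      forall q, W q -> lambda q = (<[Y0 q]> + <[Y1 q]>)%VS].

(* The space of lines of the quadric is an embedded submanifold of the
   Grassmannian of lines, so immersions into it are immersions into the
   Grassmannian with values in it. *)
Definition legendre (R : realType) (M : topologicalType) (m n : nat)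
    (A : analytic_manifold R M m) (lambda : M -> {vspace 'rV[R]_n.+3}) : Prop :=
  [/\ forall p, lie_lines (lambda p),
      gr_immersion 2 A lambda &
      forall p, exists (W : set M) (Y0 Y1 : M -> 'rV[R]_n.+3),
        [/\ W p, lie_frame A lambda W Y0 Y1 &
            forall q phi X, W q -> chart_at A q phi ->
              lie_form (diff_in phi Y0 q X) (Y1 q) = 0]].

(* In the coordinates of the chart [phi] at [p].  The set does not depend on
   the frame, and is empty when [K] is not a point of the line [lambda p]. *)
Definition principal_space (R : realType) (M : topologicalType) (m n : nat)
    (A : analytic_manifold R M m) (lambda : M -> {vspace 'rV[R]_n.+3})
    (phi : chart R M m) (p : M) (K : {vspace 'rV[R]_n.+3}) : set 'rV[R]_m :=
  [set X | exists (W : set M) (Y0 Y1 : M -> 'rV[R]_n.+3) (r s : R),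
    [/\ W p, lie_frame A lambda W Y0 Y1, (r, s) <> (0, 0),
        K = <[r *: Y0 p + s *: Y1 p]>%VS &
        r *: diff_in phi Y0 p X + s *: diff_in phi Y1 p X
          \in (<[Y0 p]> + <[Y1 p]>)%VS]].

Definition curvature_sphere (R : realType) (M : topologicalType) (m n : nat)
    (A : analytic_manifold R M m) (lambda : M -> {vspace 'rV[R]_n.+3})
    (p : M) (K : {vspace 'rV[R]_n.+3}) : Prop :=
  exists phi X, [/\ chart_at A p phi, X <> 0 &
                    principal_space A lambda phi p K X].

(* [f] restricts to a smooth immersion of the open set [O] of R^d into [M]
   that is a homeomorphism onto an open subset of [S]. *)
Definition local_param (R : realType) (M : topologicalType) (m d : nat)
    (A : analytic_manifold R M m) (S : set M) (O : set 'rV[R]_d)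
    (f : 'rV[R]_d -> M) : Prop :=
  [/\ open O /\ {in O &, injective f},
      forall u, O u -> {for u, continuous f},
      forall O', open O' -> O' `<=` O ->
        exists2 W, open W & f @` O' = S `&` W &
      forall u phi, O u -> chart_at A (f u) phi ->
        smooth_at (phi \o f) u /\
        forall v, 'D_v (phi \o f) u = 0 -> v = 0].

Definition submanifold (R : realType) (M : topologicalType) (m d : nat)
    (A : analytic_manifold R M m) (S : set M) : Prop :=
  forall p, S p -> exists (O : set 'rV[R]_d) (f : 'rV[R]_d -> M),
    local_param A S O f /\ (f @` O) p.

Definition tangent_space (R : realType) (M : topologicalType) (m d : nat)
    (A : analytic_manifold R M m) (S : set M) (phi : chart R M m) (p : M) :
    set 'rV[R]_m :=
  [set X | exists (O : set 'rV[R]_d) (f : 'rV[R]_d -> M) (u v : 'rV[R]_d),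
    [/\ local_param A S O f, O u, f u = p & X = 'D_v (phi \o f) u]].

(* [K] is a curvature sphere at [p] whose principal space is tangent to [S]. *)
Definition surface_sphere (R : realType) (M : topologicalType) (m n d : nat)
    (A : analytic_manifold R M m) (lambda : M -> {vspace 'rV[R]_n.+3})
    (S : set M) (p : M) (K : {vspace 'rV[R]_n.+3}) : Prop :=
  curvature_sphere A lambda p K /\
  forall phi, chart_at A p phi ->
    tangent_space d A S phi p = principal_space A lambda phi p K.

Definition curvature_surface (R : realType) (M : topologicalType) (m n d : nat)
    (A : analytic_manifold R M m) (lambda : M -> {vspace 'rV[R]_n.+3})
    (S : set M) : Prop :=
  [/\ connected S, submanifold d A S &
      forall p, S p -> exists K, surface_sphere d A lambda S p K].

Definition dupin (R : realType) (M : topologicalType) (m n : nat)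
    (A : analytic_manifold R M m) (lambda : M -> {vspace 'rV[R]_n.+3}) : Prop :=
  legendre A lambda /\
  forall d S, curvature_surface d A lambda S ->
    forall p q K K', S p -> S q ->
      surface_sphere d A lambda S p K -> surface_sphere d A lambda S q K' ->
      K = K'.

Definition proper_dupin (R : realType) (M : topologicalType) (m n : nat)
    (A : analytic_manifold R M m) (lambda : M -> {vspace 'rV[R]_n.+3}) : Prop :=
  dupin A lambda /\
  exists g : nat, forall p,
    ([set K | curvature_sphere A lambda p K] #= `I_g)%card.

(* The curvature spheres regarded as analytic maps from [M] to the quadric. *)
Definition curvature_sphere_map (R : realType) (M : topologicalType)
    (m n : nat) (A : analytic_manifold R M m)
    (lambda kappa : M -> {vspace 'rV[R]_n.+3}) : Prop :=
  [/\ gr_analytic 1 A kappa, forall p, lie_quadric (kappa p) &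
      forall p, curvature_sphere A lambda p (kappa p)].

(* A vector subspace [E] of R^(n+3) is a linear subspace of RP^(n+2) of
   codimension n + 3 - \dim E. *)
Definition reducible_on (R : realType) (M : topologicalType) (m n : nat)
    (A : analytic_manifold R M m) (lambda : M -> {vspace 'rV[R]_n.+3})
    (O : set M) : Prop :=
  exists (kappa : M -> {vspace 'rV[R]_n.+3}) (E : {vspace 'rV[R]_n.+3}),
    [/\ curvature_sphere_map A lambda kappa, (\dim E + 2 <= n.+3)%N &
        forall p, O p -> (kappa p <= E)%VS].

Definition reducible (R : realType) (M : topologicalType) (m n : nat)
    (A : analytic_manifold R M m) (lambda : M -> {vspace 'rV[R]_n.+3}) : Prop :=
  reducible_on A lambda [set: M].

Definition irreducible (R : realType) (M : topologicalType) (m n : nat)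
    (A : analytic_manifold R M m) (lambda : M -> {vspace 'rV[R]_n.+3}) : Prop :=
  ~ reducible A lambda.

Definition locally_irreducible (R : realType) (M : topologicalType) (m n : nat)
    (A : analytic_manifold R M m) (lambda : M -> {vspace 'rV[R]_n.+3}) : Prop :=
  forall O : set M, open O -> O !=set0 -> ~ reducible_on A lambda O.

(* Main.v *)
(* The curvature sphere map [kappa] witnessing reducibility on [U] is analytic
   on all of [M], so it suffices to propagate the inclusion of [kappa p] in the
   fixed subspace [E] from [U] to [M].  In Grassmannian charts this inclusion is
   the vanishing of analytic functions, and the interior of the set where it
   holds is closed by the identity theorem.  The latter is reduced to segments:
   restricted to a line, an analytic function is the sum of its Taylor
   polynomials up to geometrically decaying remainders, hence its zeros cannot
   accumulate at a point unless it vanishes near that point. *)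
Require Import Defs.
From mathcomp Require Import ring lra.

Local Open Scope classical_set_scope.
Local Open Scope ring_scope.

(** * Power series summed over cubes of exponents *)

Definition exponent (m N : nat) (a : {ffun 'I_m -> 'I_N}) :
  {ffun 'I_m -> nat} := [ffun i => val (a i)].

Definition degree (m : nat) (a : {ffun 'I_m -> nat}) : nat :=
  (\sum_(i < m) a i)%N.

Lemma exponent_inj (m N : nat) : injective (@exponent m N).
Proof.
move=> a b /ffunP ab; apply/ffunP => i; apply: val_inj.
by have := ab i; rewrite !ffunE.
Qed.

Lemma leq_degree (m : nat) (a : {ffun 'I_m -> nat}) i : (a i <= degree a)%N.
Proof. by rewrite /degree (bigD1 i)//= leq_addr. Qed.

Lemma monomialZ (R : realType) (m : nat) (t : R) (h : 'rV[R]_m) a :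
  monomial (t *: h) a = t ^+ degree a * monomial h a.
Proof.
rewrite /monomial /degree -prodrXr -big_split /=.
by apply: eq_bigr => i _; rewrite mxE exprMn.
Qed.

(** Every entry of an exponent of degree [k] is at most [k], so the cube of side [k.+1] already
    contains all of them. The homogeneous part of degree [k] thus does not depend on [N]. *)
Lemma sum_degree_stable (R : realType) (m N k : nat)
    (F : {ffun 'I_m -> nat} -> R) : (k < N)%N ->
  \sum_(a : {ffun 'I_m -> 'I_N} | degree (exponent a) == k) F (exponent a) =
  \sum_(a : {ffun 'I_m -> 'I_k.+1} | degree (exponent a) == k)
    F (exponent a).
Proof.
move=> kN.
pose w (a : {ffun 'I_m -> 'I_k.+1}) : {ffun 'I_m -> 'I_N} :=
  [ffun i => widen_ord kN (a i)].
pose u (a : {ffun 'I_m -> 'I_N}) : {ffun 'I_m -> 'I_k.+1} :=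
  [ffun i => inord (a i)].
have ew a : exponent (w a) = exponent a by apply/ffunP => i; rewrite !ffunE.
rewrite (reindex_onto w u) => [|a /eqP ak].
  apply: eq_big => [a|a _]; last by rewrite ew.
  rewrite ew; case: eqP => //= _; apply/eqP/ffunP => i; apply: val_inj.
  by rewrite !ffunE /= inord_val.
apply/ffunP => i; apply: val_inj; rewrite !ffunE /= inordK // ltnS -ak.
by have := leq_degree (exponent a) i; rewrite ffunE.
Qed.

(** As [exponent] is injective, each cube sum is a finite partial sum of the convergent total, which
    serves as [C]. *)
Lemma summable_exponent_bound (R : realType) (m : nat)
    (F : {ffun 'I_m -> nat} -> R) :
  summable [set: {ffun 'I_m -> nat}] (fun a => (F a)%:E) ->
  exists2 C : R, 0 <= C &
    forall N, \sum_(a : {ffun 'I_m -> 'I_N}) `|F (exponent a)| <= C.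
Proof.
move=> sF; have := sF; rewrite summableE => fF.
exists (fine (\esum_(a in [set: {ffun 'I_m -> nat}]) `|(F a)%:E|)%E).
  by apply/fine_ge0/esum_ge0.
move=> N; rewrite -lee_fin fineK //; apply: esum_ge.
exists [set` map (@exponent m N) (enum {ffun 'I_m -> 'I_N})].
  by split=> //; exact: finite_seq.
rewrite -fsbig_seq; first by rewrite big_map big_enum /= -sumEFin.
by rewrite map_inj_uniq ?enum_uniq//; exact: exponent_inj.
Qed.

(** * Expansions along a line *)

(* A Taylor expansion at [t0] whose remainders decay geometrically in the order
   [K], uniformly for [|t| <= 1/B]. *)
Definition line_expansion (R : realType) (g : R -> R) (t0 : R) : Prop :=
  exists (b : nat -> R) (C B : R), [/\ 0 <= C, 0 < B &
    forall t K, `|t| * B <= 1 ->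
      `|g (t0 + t) - \sum_(k < K) b k * t ^+ k| <= C * (`|t| * B) ^+ K].

Lemma line_expansion_scale (R : realType) (g : R -> R) (t0 l : R) :
  line_expansion g t0 -> line_expansion (fun t => g t * l) t0.
Proof.
move=> [b [C [B [C0 B0 H]]]].
exists (fun k => b k * l), (C * `|l|), B; split=> // [|t K tB].
  exact: mulr_ge0.
have -> : \sum_(k < K) b k * l * t ^+ k = (\sum_(k < K) b k * t ^+ k) * l.
  by rewrite mulr_suml; apply: eq_bigr => k _; rewrite mulrAC.
by rewrite -mulrBl normrM mulrAC ler_wpM2r// H.
Qed.

Lemma line_expansion_add (R : realType) (g1 g2 : R -> R) (t0 : R) :
  line_expansion g1 t0 -> line_expansion g2 t0 ->
  line_expansion (fun t => g1 t + g2 t) t0.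
Proof.
move=> [b1 [C1 [B1 [C10 B10 H1]]]] [b2 [C2 [B2 [C20 B20 H2]]]].
exists (fun k => b1 k + b2 k), (C1 + C2), (Num.max B1 B2).
split=> [||t K tB]; first exact: addr_ge0.
  by rewrite lt_max B10.
have mono (D : R) : 0 < D -> D <= Num.max B1 B2 ->
    `|t| * D <= 1 /\ (`|t| * D) ^+ K <= (`|t| * Num.max B1 B2) ^+ K.
  move=> D0 DB; have tD : `|t| * D <= `|t| * Num.max B1 B2.
    by rewrite ler_wpM2l.
  split; first exact: le_trans tD tB.
  by rewrite lerXn2r// nnegrE mulr_ge0// ?(ltW D0)// le_max (ltW B10).
have B1M : B1 <= Num.max B1 B2 by rewrite le_max lexx.
have B2M : B2 <= Num.max B1 B2 by rewrite le_max lexx orbT.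
have [t1 m1] := mono B1 B10 B1M.
have [t2 m2] := mono B2 B20 B2M.
have -> : \sum_(k < K) (b1 k + b2 k) * t ^+ k =
    \sum_(k < K) b1 k * t ^+ k + \sum_(k < K) b2 k * t ^+ k.
  by rewrite -big_split/=; apply: eq_bigr => k _; rewrite mulrDl.
rewrite opprD addrACA (le_trans (ler_normD _ _))// mulrDl lerD//.
  by rewrite (le_trans (H1 _ _ t1))// ler_wpM2l.
by rewrite (le_trans (H2 _ _ t2))// ler_wpM2l.
Qed.

(** Meant for the entries of a product of an analytic matrix with a constant one. *)
Lemma line_expansion_sum (R : realType) (I : finType) (g : I -> R -> R)
    (l : I -> R) (t0 : R) :
  (forall i, line_expansion (g i) t0) ->
  line_expansion (fun t => \sum_i g i t * l i) t0.
Proof.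
move=> H; elim: (index_enum I) => [|i s IHs].
  exists (fun=> 0), 0, 1; split=> // t K _.
  rewrite big_nil big1 => [|k _]; last by rewrite mul0r.
  by rewrite subr0 normr0 mul0r.
rewrite (_ : (fun t => _) =
    fun t => g i t * l i + \sum_(j <- s) g j t * l j); last first.
  by apply/funext => t; rewrite big_cons.
by apply: line_expansion_add => //; exact: line_expansion_scale.
Qed.

(** Grouping the series by degree gives the coefficients along the line. The terms of degree at
    least [K] share a factor [s ^+ K], and absolute convergence at one fixed [h] bounds the rest. *)
Lemma analytic_line_expansion (R : realType) (m : nat) (f : 'rV[R]_m -> R)
    (x w : 'rV[R]_m) (t0 : R) :
  analytic_at f (x + t0 *: w) -> line_expansion (fun t => f (x + t *: w)) t0.
Proof.
move=> [c [r [r0 H]]].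
(* This makes [w / B] shorter than [r / 2]; the summand 1 keeps [B] positive when [w = 0]. *)
pose B := `|w| / (r / 2) + 1.
have B0 : 0 < B by rewrite /B ltr_wpDl// divr_ge0// ltW// divr_gt0.
pose h := B^-1 *: w.
have hr : `|h| < r.
  rewrite normrZ gtr0_norm ?invr_gt0// mulrC ltr_pdivrMr// /B mulrDr mulr1.
  have -> : r * (`|w| / (r / 2)) = 2 * `|w| by field; rewrite gt_eqF.
  by have := normr_ge0 w; lra.
have [sF _] := H h hr.
have [C C0 HC] := summable_exponent_bound sF.
pose F a := c a * monomial h a.
pose b k := \sum_(a : {ffun 'I_m -> 'I_k.+1} | degree (exponent a) == k)
  F (exponent a).
exists (fun k => b k * B ^+ k), C, B; split=> // t K tB.
pose s := t * B.
have s1 : `|s| <= 1 by rewrite normrM (gtr0_norm B0).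
have tw : t *: w = s *: h.
  by rewrite scalerA /s mulfK ?gt_eqF.
have -> : \sum_(k < K) b k * B ^+ k * t ^+ k = \sum_(k < K) b k * s ^+ k.
  by apply: eq_bigr => k _; rewrite exprMn -mulrA; congr (_ * _); rewrite mulrC.
have -> : `|t| * B = `|s| by rewrite normrM (gtr0_norm B0).
have shr : `|s *: h| < r.
  by rewrite normrZ (le_lt_trans _ hr)// ler_piMl.
have [_ Hs] := H _ shr.
rewrite scalerDl addrA tw.
apply: (cvgr_to_le (cvg_norm (cvgB Hs (cvg_cst (\sum_(k < K) b k * s ^+ k))))).
near=> N.
have KN : (K <= N)%N by near: N; exact: nbhs_infty_ge.
rewrite -[X in `|X|]/(\sum_(a : {ffun 'I_m -> 'I_N})
    c (exponent a) * monomial (s *: h) (exponent a) -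
    \sum_(k < K) b k * s ^+ k).
have -> : \sum_(k < K) b k * s ^+ k =
  \sum_(a : {ffun 'I_m -> 'I_N} | (degree (exponent a) < K)%N)
     F (exponent a) * s ^+ degree (exponent a).
  (* The partition by degree below needs an element of ['I_K] as default value. *)
  case: (posnP K) => [K0|K0].
    rewrite [RHS]big_pred0 => [|a]; last by rewrite K0.
    by apply: big1 => -[k kK] _; exfalso; rewrite K0 in kK.
  rewrite [RHS](partition_big (fun a => insubd (Ordinal K0) (degree (exponent a))) xpredT)//=.
  apply: eq_bigr => k _.
  rewrite /b -(@sum_degree_stable _ _ N k F) ?(leq_trans (ltn_ord k))//.
  rewrite mulr_suml; apply: eq_big => [a|a /eqP ->//].
  case: (ltnP (degree (exponent a)) K) => aK /=.
    by rewrite -val_eqE /= val_insubd aK.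
  by apply/eqP => ak; move: aK; rewrite ak leqNgt ltn_ord.
rewrite (bigID (fun a => (degree (exponent a) < K)%N))/=.
rewrite (eq_bigr (fun a => F (exponent a) * s ^+ degree (exponent a))) => [|a _].
  rewrite addrAC subrr add0r (le_trans (ler_norm_sum _ _ _))//.
  (* Only degrees at least [K] remain, where [|s| <= 1] bounds the power of [|s|] by [|s| ^+ K]. *)
  apply: (@le_trans _ _ ((\sum_(a : {ffun 'I_m -> 'I_N}) `|F (exponent a)|) * `|s| ^+ K)).
    rewrite mulr_suml [leRHS](bigID (fun a => (degree (exponent a) < K)%N))/=.
    rewrite ler_wpDl//; first by apply: sumr_ge0 => a _; rewrite mulr_ge0// exprn_ge0.
    apply: ler_sum => a; rewrite -leqNgt => aK.
    rewrite monomialZ mulrCA mulrC normrM ler_wpM2l// normrX.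
    by rewrite ler_wiXn2l.
  by rewrite ler_wpM2r// exprn_ge0.
by rewrite monomialZ mulrCA mulrC.
Unshelve. all: by end_near.
Qed.

(* The order of vanishing at [t0] is infinite, so all Taylor coefficients
   vanish, and the geometric remainders force [g] to vanish. *)
Lemma line_expansion_left_zero (R : realType) (g : R -> R) (t0 d : R) :
  line_expansion g t0 -> 0 < d ->
  (forall s, 0 < s < d -> g (t0 - s) = 0) ->
  exists2 e, 0 < e & forall t, `|t| < e -> g (t0 + t) = 0.
Proof.
move=> [b [C [B [C0 B0 H]]]] d0 gz.
have b0 k : b k = 0.
  (* Once the lower coefficients vanish, the remainder of order [k.+1] at [- s] gives
     [|b k| <= C * B ^+ k.+1 * s], and [s] tends to 0. *)
  elim/ltn_ind: k => k IH; apply/eqP; rewrite -normr_le0.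
  have cv : (C * B ^+ k.+1) * s @[s --> 0^'+] --> (C * B ^+ k.+1) * 0.
    by apply: cvgM; [exact: cvg_cst | exact: cvg_at_right_filter].
  rewrite mulr0 in cv.
  apply: (cvgr_to_ge cv); near=> s.
  have s0 : 0 < s by near: s; exact: nbhs_right_gt.
  have sB : `|- s| * B <= 1.
    rewrite normrN gtr0_norm// -ler_pdivlMr// div1r.
    by near: s; apply: nbhs_right_le; rewrite invr_gt0.
  have := H (- s) k.+1 sB.
  rewrite gz; last by rewrite s0/=; near: s; exact: nbhs_right_lt.
  rewrite big_ord_recr/= big1 => [|i _]; last by rewrite IH ?mul0r.
  rewrite sub0r add0r normrN normrM normrX normrN (gtr0_norm s0).
  have -> : C * (s * B) ^+ k.+1 = C * B ^+ k.+1 * s * s ^+ k.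
    by rewrite exprMn !exprS; ring.
  by rewrite ler_pM2r// exprn_gt0.
(* On this radius the remainder of order [K] is at most [C * 2^-1 ^+ K]. *)
exists (2 * B)^-1; first by rewrite invr_gt0 mulr_gt0.
move=> t tB; apply/eqP; rewrite -normr_le0.
have tB2 : `|t| * B <= 2^-1.
  by rewrite -ler_pdivlMr// -invfM; exact: ltW.
have half : `|2^-1 : R| < 1 by rewrite ger0_norm; lra.
apply: (cvgr_to_ge (cvg_geometric C half)); near=> K.
have := H t K (le_trans tB2 _); rewrite big1 => [|k _]; last by rewrite b0 mul0r.
rewrite subr0 => /(_ _)/le_trans; apply; first by lra.
by rewrite /geometric/= ler_wpM2l// lerXn2r// nnegrE ?mulr_ge0// ?(ltW B0)//; lra.
Unshelve. all: by end_near.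
Qed.

(** Otherwise let [inf Z] be the infimum of the nonzeros in the unit interval. Just to its left [g]
    vanishes, hence also on both sides of it, although nonzeros lie arbitrarily close. *)
Lemma line_expansion_identity (R : realType) (g : R -> R) (e : R) :
  (forall t, 0 <= t <= 1 -> line_expansion g t) -> 0 < e ->
  (forall t, 0 <= t < e -> g t = 0) -> g 1 = 0.
Proof.
move=> ge e0 gz; apply/eqP/negP => /negP g1.
pose Z := [set t : R | 0 <= t <= 1 /\ g t != 0].
have Z1 : Z 1 by split=> //; rewrite ler01 lexx.
have lZ : lbound Z e.
  move=> t [/andP[t0 _] gt]; rewrite leNgt; apply/negP => te.
  by move/eqP: gt; apply; apply: gz; rewrite t0.
have hZ : has_inf Z by split; [exists 1 | exists e].
have eT : e <= inf Z by apply: lb_le_inf => //; exists 1.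
have T1 : inf Z <= 1 by apply: ge_inf => //; exists e.
have [|||r r0 gr] := @line_expansion_left_zero _ g (inf Z) e.
- by apply: ge; rewrite T1 (le_trans _ eT)// ltW.
- exact: e0.
- move=> s /andP[s0 se]; apply/eqP/negP => /negP gs.
  suff /(ge_inf hZ.2) : Z (inf Z - s) by lra.
  by split=> //; lra.
have [z Zz zr] := inf_adherent r0 hZ.
have Tz := ge_inf hZ.2 Zz.
case: Zz => _ /eqP; apply; rewrite -(subrK (inf Z) z) addrC.
by apply: gr; rewrite ger0_norm; lra.
Qed.

(** * The identity theorem on a ball *)

Lemma analytic_mx_identity (R : realType) (m k l q : nat)
    (f : 'rV[R]_m -> 'M[R]_(k, l)) (P : 'M[R]_(l, q)) (x : 'rV[R]_m) (e : R)
    (u0 : 'rV[R]_m) :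
  (forall u, ball x e u -> analytic_mx_at f u) -> ball x e u0 ->
  (\forall u \near u0, f u *m P = 0) ->
  forall u, ball x e u -> f u *m P = 0.
Proof.
move=> fa xu0 fP u xu; apply/matrixP => i j; rewrite [RHS]mxE.
pose g t := (f (u0 + t *: (u - u0)) *m P) i j.
suff : g 1 = 0 by rewrite /g scale1r addrC subrK.
have [d d0 dP] : exists2 d, 0 < d & forall t, 0 <= t < d -> g t = 0.
  have /nbhs_ballP[r /= r0 rP] := fP.
  pose c := `|u - u0| + 1.
  have c0 : 0 < c by rewrite ltr_wpDl.
  exists (r / c); first exact: divr_gt0.
  move=> t /andP[t0 tr]; rewrite /g rP ?mxE// -ball_normE /ball_/=.
  rewrite opprD addrA subrr sub0r normrN normrZ ger0_norm//.
  move: tr; rewrite ltr_pdivlMr//; apply: le_lt_trans.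
  by rewrite ler_wpM2l// lerDl.
apply: (@line_expansion_identity _ g d) => // t /andP[t0 t1].
rewrite (_ : g = fun t =>
    \sum_a f (u0 + t *: (u - u0)) i a * P a j); last first.
  by apply/funext => s; rewrite /g mxE.
apply: line_expansion_sum => a.
apply: (@analytic_line_expansion _ _ (fun u => f u i a)).
apply: fa; move: xu0 xu; rewrite -!ball_normE /ball_/= => xu0 xu.
have -> : x - (u0 + t *: (u - u0)) = (1 - t) *: (x - u0) + t *: (x - u).
  rewrite scalerBl scale1r !scalerBr; apply/matrixP => a' b'.
  by rewrite !mxE; ring.
rewrite (le_lt_trans (ler_normD _ _))// !normrZ ger0_norm ?subr_ge0//.
rewrite (ger0_norm t0).
set a' := `|x - u0| in xu0 *; set b' := `|x - u| in xu *.
have ab : Num.max a' b' < e by rewrite gt_max xu0.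
(* These two products make the convexity bound [(1 - t) * a' + t * b' <= Num.max a' b'] linear for
   [lra]: the segment stays in the ball. *)
have ha : 0 <= (1 - t) * (Num.max a' b' - a').
  by rewrite mulr_ge0 ?subr_ge0// le_max lexx.
have hb : 0 <= t * (Num.max a' b' - b').
  by rewrite mulr_ge0 ?subr_ge0// le_max lexx orbT.
by lra.
Qed.

(** A vector lies in [E] exactly when [projv E] fixes it; inclusion becomes a linear equation in the
    entries of [Z], ready for the identity theorem. *)
Lemma row_span_subvE (R : realType) (k N : nat) (Z : 'M[R]_(k, N))
    (E : {vspace 'rV[R]_N}) :
  (row_span Z <= E)%VS <-> Z *m (1%:M - lin1_mx (projv E)) = 0.
Proof.
have projE v : (v \in E) = (v - projv E v == 0).
  rewrite subr_eq0; apply/idP/eqP => [/projv_id->//|vE].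
  by rewrite vE memv_proj.
have rowE i : row i (Z *m (1%:M - lin1_mx (projv E))) =
    row i Z - projv E (row i Z).
  by rewrite row_mul mulmxBr mulmx1 mul_rV_lin1.
split=> [/span_subvP sE|Z0].
  apply/row_matrixP => i; rewrite rowE row0; apply/eqP; rewrite -projE.
  by apply: sE; apply: map_f; rewrite mem_enum.
apply/span_subvP => _ /mapP[i _ ->].
by rewrite projE -rowE Z0 row0.
Qed.

Lemma gr_coordK (R : realType) (k N : nat) (I : 'I_k -> 'I_N)
    (L : {vspace 'rV[R]_N}) :
  gr_dom I L -> row_span (gr_coord I L) = L.
Proof. by move=> LI; have [] := xgetPex 0 LI. Qed.

Lemma gr_analytic_subv (R : realType) (M : topologicalType) (m k N : nat)
    (A : analytic_manifold R M m) (L : M -> {vspace 'rV[R]_N})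
    (E : {vspace 'rV[R]_N}) (U : set M) :
  connected [set: M] -> gr_analytic k A L -> open U -> U !=set0 ->
  (forall p, U p -> (L p <= E)%VS) -> forall p, (L p <= E)%VS.
Proof.
move=> Mc La Uo [p0 Up0] UE.
(* With the interior, openness is automatic and only closedness needs analyticity. *)
pose S := [set p | (L p <= E)%VS]°.
suff ST : S = [set: M].
  by move=> p; have /interior_subset : S p by rewrite ST.
apply: Mc.
- by exists p0; apply: (filterS UE); exact: open_nbhs_nbhs.
- by exists S; [exact: open_interior | rewrite setTI].
exists (closure S); first exact: closed_closure.
rewrite setTI; apply/seteqP; split=> [|p Sp]; first exact: subset_closure.
have [I [W [Wo Wp WI Wa]]] := La p.
have [phi phiA phip] := atlas_cover A p.
set P := 1%:M - lin1_mx (projv E).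
pose D := W `&` chart_dom phi.
have Do : open D by apply: openI => //; exact: chart_dom_open.
pose f := (gr_coord I \o L) \o chart_inv phi.
have phiK q : D q -> chart_inv phi (phi q) = q.
  by move=> [_ qd]; apply: chart_mapK; rewrite inE.
have LE q : D q -> (L q <= E)%VS <-> f (phi q) *m P = 0.
  move=> Dq; rewrite -row_span_subvE /f/= phiK// gr_coordK//.
  by apply: WI; case: Dq.
(* The ball must lie within the image of [D], where [chart_inv phi] really inverts [phi] and [f] is
   analytic. *)
have [e e0 eD] : exists2 e, 0 < e &
    forall u, ball (phi p) e u -> exists2 q, D q & phi q = u.
  have img : nbhs (phi p) (phi @` chart_dom phi).
    by apply: open_nbhs_nbhs; split; [exact: chart_img_open | exists p].
  have pre : nbhs (phi p) (chart_inv phi @^-1` D).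
    apply: chart_inv_continuous; first by exists p.
    by rewrite phiK//; apply: open_nbhs_nbhs.
  have [e /= e0 eS] := (nbhs_ballP _ _).1 (filterI img pre).
  exists e => // u /eS[[q qd <-]] Dq; exists q => //.
  by move: Dq; rewrite /preimage/= (chart_mapK _)// inE.
have nB : nbhs p (D `&` phi @^-1` ball (phi p) e).
  apply: filterI; first exact: open_nbhs_nbhs.
  by apply: chart_map_continuous => //; exact: nbhsx_ballx.
(* Since [p] is in the closure of [S], some [q] of [S] has coordinates in the ball; vanishing near
   [phi q] then spreads to the whole ball. *)
have [q [Sq [Dq qe]]] := Sp _ nB.
have fB u : ball (phi p) e u -> f u *m P = 0.
  apply: (@analytic_mx_identity _ _ _ _ _ f P (phi p) e (phi q)) => //.
    by move=> _ /eD[q' [Wq' dq'] <-]; exact: Wa.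
  have nq : nbhs (phi q) (chart_inv phi @^-1` (S `&` D)).
    apply: chart_inv_continuous; first by exists q => //; case: Dq.
    rewrite phiK//; apply: open_nbhs_nbhs; split=> //.
    by apply: openI => //; exact: open_interior.
  have nimg : nbhs (phi q) (ball (phi p) e).
    by apply: open_nbhs_nbhs; split=> //; exact: ball_open.
  apply: filterS (filterI nq nimg) => y [[Sy Dy] /eD[q' Dq' q'y]].
  rewrite -q'y -LE// -(phiK _ Dq') q'y.
  exact: interior_subset Sy.
by apply: (filterS _ nB) => q' [Dq' q'e]; apply/(LE _ Dq')/fB.
Qed.

Theorem proposition9 (R : realType) (n : nat) (hn : (0 < n)%N)
    (M : topologicalType) (A : analytic_manifold R M n.-1)
    (M_nonempty : [set: M] !=set0) (M_connected : connected [set: M])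
    (lambda : M -> {vspace 'rV[R]_n.+3})
    (lambda_dupin : proper_dupin A lambda) :
  (forall U : set M, open U -> U !=set0 ->
     reducible_on A lambda U -> reducible A lambda) /\
  (locally_irreducible A lambda <-> irreducible A lambda).
Proof.
have ext (U : set M) : open U -> U !=set0 ->
    reducible_on A lambda U -> reducible A lambda.
  move=> Uo U0 [kappa [E [km dimE UE]]]; exists kappa, E; split=> // p _.
  have [ka _ _] := km.
  exact: (gr_analytic_subv M_connected ka Uo U0 UE).
split; first exact: ext.
split=> [loc|irr O Oo O0 red]; first exact: (loc _ openT M_nonempty).
exact: irr (ext _ Oo O0 red).
Qed.
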